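(* Let $\hat{\Pi}_t=\hat{\sigma}_t(M_t)$, $t=0,\dots,T$, be approximate information states with parameters $\epsilon_t\in\mathbb{R}_{\ge0}$, and let $L_{\hat{V}_{t+1}}$ be the Lipschitz constant of $\hat{V}_{t+1}$ for all $t=0,\dots,T-1$. Let $\boldsymbol{g}=(g_0,\dots,g_T)$ be the memory-based strategy $g_t(m_t)=\hat{g}_t^*(\hat{\sigma}_t(m_t))$, where $\hat{g}_t^*(\hat{\pi}_t)\in\arg\min_{u_t\in\mathcal{U}}\hat{Q}_t(\hat{\pi}_t,u_t)$, and let $\Theta_t,\Lambda_t$ be its performance value functions. Then for all $t=0,\dots,T$, all $m_t\in\mathcal{M}_t$ and all $u_t\in\mathcal{U}$, $$|Q_t(m_t,u_t)-\Theta_t(m_t,u_t)|\le2\alpha_t,\qquad |V_t(m_t)-\Lambda_t(m_t)|\le2\alpha_t,$$ where $\alpha_T=(L_{c_T}+1)\cdot\epsilon_T$ and, for $t=0,\dots,T-1$, $\alpha_t=\alpha_{t+1}+(2L_t+1)\cdot\epsilon_t$ with $L_t=\max\{L_{\hat{V}_{t+1}},L_{c_t}\}$.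
   Context: **System.** Let $T\in\mathbb{N}$ and let $\mathcal{X},\mathcal{U},\mathcal{Y},\mathcal{W},\mathcal{N}$ be finite nonempty subsets of a metric space $(\mathcal{S},d)$. The data are functions $f_t:\mathcal{X}\times\mathcal{U}\times\mathcal{W}\to\mathcal{X}$ ($t=0,\dots,T-1$), $h_t:\mathcal{X}\times\mathcal{N}\to\mathcal{Y}$ and $c_t:\mathcal{X}\times\mathcal{U}\to\mathbb{R}_{\ge0}$ ($t=0,\dots,T$). The state evolves by $X_{t+1}=f_t(X_t,U_t,W_t)$ from $X_0\in\mathcal{X}$, the observation is $Y_t=h_t(X_t,N_t)$, and the memory is $M_t=(Y_{0:t},U_{0:t-1})$ (so $M_0=Y_0$). The accrued cost is $A_t=\sum_{\ell=0}^{t-1}c_\ell(X_\ell,U_\ell)$, $A_0=0$, taking values in a finite set $\mathcal{A}_t\subset\mathbb{R}_{\ge0}$. The uncontrolled inputs $X_0$, $W_t$ ($t\le T-1$), $N_t$ ($t\le T$) are mutually independent in the non-stochastic sense: their joint range is the full product of $\mathcal{X}$, copies of $\mathcal{W}$ and copies of $\mathcal{N}$. **Ranges.** An uncertain variable is a map on a sample space $\Omega$. For uncertain variables $\mathsf{X},\mathsf{Y}$, $[[\mathsf{X}]]=\{\mathsf{X}(\omega):\omega\in\Omega\}$ and $[[\mathsf{X}|\mathsf{y}]]=\{\mathsf{X}(\omega):\omega\in\Omega,\ \mathsf{Y}(\omega)=\mathsf{y}\}$; tuples are treated as single uncertain variables. Conditional ranges of system variables (given realizations such as $m_t$, $(m_t,u_t)$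 or $(\hat{\pi}_t,u_t)$) do not depend on a strategy: they are taken on $\Omega=\mathcal{X}\times\mathcal{W}^{T}\times\mathcal{N}^{T+1}\times\mathcal{U}^{T+1}$, the set of all realizations of the uncontrolled inputs and of action sequences $u_{0:T}$. $\mathcal{M}_t=[[M_t]]$ is the set of realizable memories. **Indicator and accrued distribution.** $\mathbb{I}(\mathsf{x}|\mathsf{y})=0$ if $\mathsf{x}\in[[\mathsf{X}|\mathsf{y}]]$ and $-\infty$ otherwise. For $\mathsf{y}\in[[\mathsf{Y}]]$, $$r_t(\mathsf{x}|\mathsf{y})=\max_{a_t\in\mathcal{A}_t}\big(a_t+\mathbb{I}(\mathsf{x},a_t|\mathsf{y})\big)-\max_{a_t\in\mathcal{A}_t}\big(a_t+\mathbb{I}(a_t|\mathsf{y})\big)\in\{-\infty\}\cup(-\infty,0],$$ with a real number plus $-\infty$ equal to $-\infty$. It is finite exactly when $\mathsf{x}\in[[\mathsf{X}|\mathsf{y}]]$. The function $\mathsf{x}\mapsto r_t(\mathsf{x}|\mathsf{y})$ is written $r_t(\mathsf{X}|\mathsf{y})$. **Distance.** For nonempty finite sets $\mathscr{A},\mathscr{B}$ in a metric space, $\mathcal{H}(\mathscr{A},\mathscr{B})=\max\{\max_{x\in\mathscr{A}}\min_{y\in\mathscr{B}}d(x,y),\max_{y\in\mathscr{B}}\min_{x\in\mathscr{A}}d(x,y)\}$. For an uncertain variable $\mathsf{X}$ with values in a finite subset of a metric space and realizations $\mathsf{y},\mathsf{z}$ of uncertain variables, $$\mathcal{R}\big(r_t(\mathsf{X}|\mathsf{y}),r_t(\mathsf{X}|\mathsf{z})\big)=\max\Big(\mathcal{H}\big([[\mathsf{X}|\mathsf{y}]],[[\mathsf{X}|\mathsf{z}]]\big),\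 \max_{\mathsf{x}\in[[\mathsf{X}|\mathsf{y}]]\cup[[\mathsf{X}|\mathsf{z}]]}\big|r_t(\psi^{\mathsf{y}}(\mathsf{x})|\mathsf{y})-r_t(\psi^{\mathsf{z}}(\mathsf{x})|\mathsf{z})\big|\Big),$$ where $\psi^{\mathsf{y}}(\mathsf{x})\in\arg\min_{\hat{\mathsf{x}}\in[[\mathsf{X}|\mathsf{y}]]}d(\hat{\mathsf{x}},\mathsf{x})$ and $\psi^{\mathsf{z}}(\mathsf{x})\in\arg\min_{\hat{\mathsf{x}}\in[[\mathsf{X}|\mathsf{z}]]}d(\hat{\mathsf{x}},\mathsf{x})$ (any fixed selections). Products of metric spaces carry the maximum metric. **Memory-based dynamic program.** $Q_T(m_T,u_T)=\max_{x_T\in\mathcal{X}}(c_T(x_T,u_T)+r_T(x_T|m_T))$; for $t<T$, $$Q_t(m_t,u_t)=\max_{x_t\in\mathcal{X},\,m_{t+1}\in\mathcal{M}_{t+1}}\big(c_t(x_t,u_t)+V_{t+1}(m_{t+1})+r_t(x_t,m_{t+1}|m_t,u_t)\big);$$ for all $t$, $V_t(m_t)=\min_{u_t\in\mathcal{U}}Q_t(m_t,u_t)$. **Approximate information state.** For each $t=0,\dots,T$, it is an uncertain variable $\hat{\Pi}_t=\hat{\sigma}_t(M_t)$ with values in a finite subset $\hat{\mathcal{P}}_t=[[\hat{\Pi}_t]]$ of some metric space, $\hat{\sigma}_t:\mathcal{M}_t\to\hat{\mathcal{P}}_t$, with a parameter $\epsilon_t\ge0$ such that for all $m_t\in\mathcal{M}_t$,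 $u_t\in\mathcal{U}$: $\mathcal{R}\big(r_t(X_t,\hat{\Pi}_{t+1}|m_t,u_t),\,r_t(X_t,\hat{\Pi}_{t+1}|\hat{\sigma}_t(m_t),u_t)\big)\le\epsilon_t$ for $t=0,\dots,T-1$, and $\mathcal{R}\big(r_T(X_T|m_T),\,r_T(X_T|\hat{\sigma}_T(m_T))\big)\le\epsilon_T$. **Approximate dynamic program.** $\hat{Q}_T(\hat{\pi}_T,u_T)=\max_{x_T\in\mathcal{X}}(c_T(x_T,u_T)+r_T(x_T|\hat{\pi}_T,u_T))$; for $t<T$, $$\hat{Q}_t(\hat{\pi}_t,u_t)=\max_{x_t\in\mathcal{X},\,\hat{\pi}_{t+1}\in\hat{\mathcal{P}}_{t+1}}\big(\hat{V}_{t+1}(\hat{\pi}_{t+1})+c_t(x_t,u_t)+r_t(x_t,\hat{\pi}_{t+1}|\hat{\pi}_t,u_t)\big);$$ for all $t$, $\hat{V}_t(\hat{\pi}_t)=\min_{u_t\in\mathcal{U}}\hat{Q}_t(\hat{\pi}_t,u_t)$. **Performance value functions of $\boldsymbol{g}$.** $\Theta_T(m_T,u_T)=\max_{x_T\in\mathcal{X}}(c_T(x_T,u_T)+r_T(x_T|m_T,u_T))$; for $t<T$, $$\Theta_t(m_t,u_t)=\max_{x_t\in\mathcal{X},\,m_{t+1}\in\mathcal{M}_{t+1}}\big(\Lambda_{t+1}(m_{t+1})+c_t(x_t,u_t)+r_t(x_t,m_{t+1}|m_t,u_t)\big);$$ for all $t$, $\Lambda_t(m_t)=\Theta_t(m_t,g_t(m_t))$.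 **Lipschitz constants.** $L_{c_t}$ is the Lipschitz constant of $c_t$ on $\mathcal{X}\times\mathcal{U}$ and $L_{\hat{V}_{t}}$ that of $\hat{V}_t$ on $\hat{\mathcal{P}}_t$ (finite because the sets are finite). *)

(* Defs.v *)
From HB Require Import structures.
From mathcomp Require Import all_boot all_order all_algebra finmap.
From mathcomp Require Import all_classical all_reals all_analysis.

Set Implicit Arguments.
Unset Strict Implicit.
Unset Printing Implicit Defensive.

Import Order.TTheory GRing.Theory Num.Theory.
Local Open Scope fset_scope.
Local Open Scope ring_scope.
Local Open Scope ereal_scope.

Section UncertainVariables.
Context {R : realType} {Om : finType}.

(* [[X]] *)
Definition vrange {A : choiceType} (X : Om -> A) : {fset A} :=
  [fset X w | w : Om].

(* [[X|y]] for a realization y of Y *)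
Definition crange {A B : choiceType} (X : Om -> A) (Y : Om -> B) (y : B) :
    {fset A} :=
  [fset X w | w : Om & Y w == y].

(* I(x|y) *)
Definition indic {A B : choiceType} (X : Om -> A) (Y : Om -> B)
    (x : A) (y : B) : \bar R :=
  if x \in crange X Y y then 0 else -oo.

(* r(x|y) relative to the accrued cost C. The maxima range over [[C]]: a cost
   value outside [[C]] would only contribute -oo. For y in [[Y]] the subtracted
   maximum is finite, so no -oo - -oo occurs. *)
Definition accr {A B : choiceType} (C : Om -> R) (X : Om -> A) (Y : Om -> B)
    (x : A) (y : B) : \bar R :=
  \big[maxe/-oo]_(a <- vrange C)
     (a%:E + indic (fun w => (X w, C w)) Y (x, a) y)
  - \big[maxe/-oo]_(a <- vrange C) (a%:E + indic C Y a y).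

(* Hausdorff distance of nonempty finite sets, for the distance d *)
Definition hausdorff_dist {A : choiceType} (d : A -> A -> R) (D E : {fset A}) :
    \bar R :=
  maxe (\big[maxe/-oo]_(x <- D) \big[mine/+oo]_(y <- E) (d x y)%:E)
       (\big[maxe/-oo]_(y <- E) \big[mine/+oo]_(x <- D) (d x y)%:E).

(* psi x is a point of argmin_(x' in D) d(x', x), for every x *)
Definition argmin_selection {A : choiceType} (d : A -> A -> R) (D : {fset A})
    (psi : A -> A) : Prop :=
  forall x, psi x \in D /\ forall x', x' \in D -> (d (psi x) x <= d x' x)%R.

(* The distance of r(X|y) and r(X|z), computed with the selections psiy, psiz *)
Definition accr_dist {A B1 B2 : choiceType} (d : A -> A -> R)
    (C : Om -> R) (X : Om -> A)
    (Y : Om -> B1) (y : B1) (psiy : A -> A)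
    (Z : Om -> B2) (z : B2) (psiz : A -> A) : \bar R :=
  maxe (hausdorff_dist d (crange X Y y) (crange X Z z))
       (\big[maxe/-oo]_(x <- crange X Y y `|` crange X Z z)
          `| accr C X Y (psiy x) y - accr C X Z (psiz x) z |).

End UncertainVariables.

Definition maxdist {R : realType} {A B : Type} (dA : A -> A -> R)
    (dB : B -> B -> R) (p q : A * B) : R :=
  Num.max (dA p.1 q.1) (dB p.2 q.2).

(* Smallest Lipschitz constant of F on the finite set D, as the largest
   difference quotient *)
Definition lip_const {R : realType} {A : choiceType} (d : A -> A -> R)
    (D : {fset A}) (F : A -> R) : R :=
  (\big[Num.max/0]_(p <- D) \big[Num.max/0]_(q <- D | p != q)
     (`|F p - F q| / d p q))%R.

(* The families are indexed by all of nat for convenience; only dyn t for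
   t < horizon, and obs t, cost t for t <= horizon, are meaningful. *)
Record system (R : realType) (S : metricType R) := System {
  horizon : nat;
  states : {fset S};
  actions : {fset S};
  observations : {fset S};
  disturbances : {fset S};
  noises : {fset S};
  states_neq0 : states != fset0;
  actions_neq0 : actions != fset0;
  observations_neq0 : observations != fset0;
  disturbances_neq0 : disturbances != fset0;
  noises_neq0 : noises != fset0;
  dyn : nat -> states -> actions -> disturbances -> states;
  obs : nat -> states -> noises -> observations;
  cost : nat -> states -> actions -> R;
  cost_ge0 : forall t x u, (t <= horizon)%N -> (0 <= cost t x u)%R
}.

Section System.
Context {R : realType} {S : metricType R} (sys : system S).
Local Notation T := (horizon sys).
Local Notation X := (states sys).
Local Notation U := (actions sys).
Local Notation Y := (observations sys).
Local Notation W := (disturbances sys).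
Local Notation N := (noises sys).

(* (x_0, w_(0:T-1), n_(0:T), u_(0:T)); taking the full product encodes the
   mutual independence of the uncontrolled inputs. *)
Definition sample : finType :=
  (X * {ffun 'I_T -> W} * {ffun 'I_T.+1 -> N} * {ffun 'I_T.+1 -> U})%type.

Definition init_state (w : sample) : X := w.1.1.1.
Definition disturbance (w : sample) : {ffun 'I_T -> W} := w.1.1.2.
Definition noise (w : sample) (t : nat) : N := w.1.2 (inord t).
Definition action (t : nat) (w : sample) : U := w.2 (inord t).

(* insub s succeeds exactly for s < T; after the horizon the state is frozen *)
Fixpoint state (t : nat) (w : sample) : X :=
  if t is s.+1 then
    if insub s is Some i then
      dyn s (state s w) (action s w) (disturbance w i)
    else state s w
  else init_state w.

Definition observation (t : nat) (w : sample) : Y :=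
  obs t (state t w) (noise w t).

(* The type of the tuples (y_(0:t), u_(0:t-1)) *)
Definition memory (t : nat) : finType :=
  ({ffun 'I_t.+1 -> Y} * {ffun 'I_t -> U})%type.

Definition mem_var (t : nat) (w : sample) : memory t :=
  ([ffun i : 'I_t.+1 => observation i w], [ffun i : 'I_t => action i w]).

Definition memories (t : nat) : {fset memory t} := vrange (mem_var t).

Definition accrued (t : nat) (w : sample) : R :=
  (\sum_(l < t) cost l (state l w) (action l w))%R.

Definition state_dist (x y : X) : R := mdist (val x) (val y).
Definition action_dist (u v : U) : R := mdist (val u) (val v).

Definition lip_cost (t : nat) : R :=
  lip_const (maxdist state_dist action_dist) [fset p | p : (X * U)%type]
            (fun p => cost t p.1 p.2).

(* r_t(x, m' | m, u) *)
Definition accr_mem (t : nat) (x : X) (m' : memory t.+1)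
    (m : memory t) (u : U) : \bar R :=
  accr (accrued t) (fun w => (state t w, mem_var t.+1 w))
       (fun w => (mem_var t w, action t w)) (x, m') (m, u).

(* Backward recursion; k is the number of remaining steps, i.e. k = T - t.
   Values are in \bar R and are finite at realizable memories. *)
Fixpoint Q_rec (k t : nat) (m : memory t) (u : U) : \bar R :=
  if k is k'.+1 then
    \big[maxe/-oo]_(x : X) \big[maxe/-oo]_(m' <- memories t.+1)
      ((cost t x u)%:E + \big[mine/+oo]_(u' : U) @Q_rec k' t.+1 m' u'
       + accr_mem x m' m u)
  else
    \big[maxe/-oo]_(x : X)
      ((cost t x u)%:E + accr (accrued t) (state t) (mem_var t) x m).

Definition Q (t : nat) (m : memory t) (u : U) : \bar R := Q_rec (T - t) m u.
Definition V (t : nat) (m : memory t) : \bar R :=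
  \big[mine/+oo]_(u : U) Q m u.

Fixpoint Theta_rec (g : forall t, memory t -> U) (k t : nat)
    (m : memory t) (u : U) : \bar R :=
  if k is k'.+1 then
    \big[maxe/-oo]_(x : X) \big[maxe/-oo]_(m' <- memories t.+1)
      (@Theta_rec g k' t.+1 m' (g t.+1 m') + (cost t x u)%:E
       + accr_mem x m' m u)
  else
    \big[maxe/-oo]_(x : X)
      ((cost t x u)%:E
       + accr (accrued t) (state t) (fun w => (mem_var t w, action t w))
              x (m, u)).

Definition Theta (g : forall t, memory t -> U) (t : nat)
    (m : memory t) (u : U) : \bar R := Theta_rec g (T - t) m u.
Definition Lambda (g : forall t, memory t -> U) (t : nat) (m : memory t) :
    \bar R := Theta g m (g t m).

(* The values of sigma t outside of the realizable memories, and sigma t for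
   t > T, play no role. *)
Context {P : nat -> metricType R} (sigma : forall t, memory t -> P t).

Definition info_var (t : nat) (w : sample) : P t := sigma (mem_var t w).

Definition infos (t : nat) : {fset P t} := vrange (info_var t).

Definition state_info (t : nat) (w : sample) : X * P t.+1 :=
  (state t w, info_var t.+1 w).
Definition state_info_dist (t : nat) : X * P t.+1 -> X * P t.+1 -> R :=
  maxdist state_dist mdist.

(* A choice of the selections psi involved in the distances between accrued
   distributions: given (m_t, u_t), given (hat pi_t, u_t), given m_T and given
   hat pi_T. *)
Record selections := Selections {
  sel_mem : forall t, memory t -> U -> X * P t.+1 -> X * P t.+1;
  sel_info : forall t, P t -> U -> X * P t.+1 -> X * P t.+1;
  sel_mem_end : memory T -> X -> X;
  sel_info_end : P T -> X -> X;
  sel_memP : forall t (m : memory t) u, (t < T)%N -> m \in memories t ->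
    argmin_selection (@state_info_dist t)
      (crange (state_info t) (fun w => (mem_var t w, action t w)) (m, u))
      (sel_mem m u);
  sel_infoP : forall t (p : P t) u, (t < T)%N -> p \in infos t ->
    argmin_selection (@state_info_dist t)
      (crange (state_info t) (fun w => (info_var t w, action t w)) (p, u))
      (sel_info p u);
  sel_mem_endP : forall m : memory T, m \in memories T ->
    argmin_selection state_dist (crange (state T) (mem_var T) m)
      (sel_mem_end m);
  sel_info_endP : forall p : P T, p \in infos T ->
    argmin_selection state_dist (crange (state T) (info_var T) p)
      (sel_info_end p)
}.

Definition approx_info_states (psi : selections) (eps : nat -> R) : Prop :=
  [/\ forall t, (t <= T)%N -> (0 <= eps t)%R,
      forall t (m : memory t) u, (t < T)%N -> m \in memories t ->
        accr_dist (@state_info_dist t) (accrued t) (state_info t)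
          (fun w => (mem_var t w, action t w)) (m, u) (sel_mem psi m u)
          (fun w => (info_var t w, action t w)) (sigma m, u)
          (sel_info psi (sigma m) u)
        <= (eps t)%:E &
      forall m : memory T, m \in memories T ->
        accr_dist state_dist (accrued T) (state T)
          (mem_var T) m (sel_mem_end psi m)
          (info_var T) (sigma m) (sel_info_end psi (sigma m))
        <= (eps T)%:E].

Fixpoint Qhat_rec (k t : nat) (p : P t) (u : U) : \bar R :=
  if k is k'.+1 then
    \big[maxe/-oo]_(x : X) \big[maxe/-oo]_(p' <- infos t.+1)
      (\big[mine/+oo]_(u' : U) @Qhat_rec k' t.+1 p' u' + (cost t x u)%:E
       + accr (accrued t) (state_info t)
              (fun w => (info_var t w, action t w)) (x, p') (p, u))
  else
    \big[maxe/-oo]_(x : X)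
      ((cost t x u)%:E
       + accr (accrued t) (state t) (fun w => (info_var t w, action t w))
              x (p, u)).

Definition Qhat (t : nat) (p : P t) (u : U) : \bar R := Qhat_rec (T - t) p u.
Definition Vhat (t : nat) (p : P t) : \bar R :=
  \big[mine/+oo]_(u : U) Qhat p u.

(* L_(hat V_t); hat V_t is finite on infos t *)
Definition lip_Vhat (t : nat) : R :=
  lip_const mdist (infos t) (fun p => fine (Vhat p)).

Definition lip_step (t : nat) : R := Num.max (lip_Vhat t.+1) (lip_cost t).

Fixpoint alpha_rec (eps : nat -> R) (k t : nat) : R :=
  (if k is k'.+1 then
     alpha_rec eps k' t.+1 + (2 * lip_step t + 1) * eps t
   else (lip_cost t + 1) * eps t)%R.

Definition alpha (eps : nat -> R) (t : nat) : R := alpha_rec eps (T - t) t.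

Lemma Q_end (m : memory T) u :
  Q m u = \big[maxe/-oo]_(x : X)
    ((cost T x u)%:E + accr (accrued T) (state T) (mem_var T) x m).
Proof. by rewrite /Q subnn. Qed.

Lemma Q_step t (m : memory t) u : (t < T)%N ->
  Q m u = \big[maxe/-oo]_(x : X) \big[maxe/-oo]_(m' <- memories t.+1)
    ((cost t x u)%:E + V m' + accr_mem x m' m u).
Proof. by move=> tT; rewrite /V /Q -(subnSK tT). Qed.

Lemma Theta_end g (m : memory T) u :
  Theta g m u = \big[maxe/-oo]_(x : X)
    ((cost T x u)%:E
     + accr (accrued T) (state T) (fun w => (mem_var T w, action T w))
            x (m, u)).
Proof. by rewrite /Theta subnn. Qed.

Lemma Theta_step g t (m : memory t) u : (t < T)%N ->
  Theta g m u = \big[maxe/-oo]_(x : X) \big[maxe/-oo]_(m' <- memories t.+1)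
    (Lambda g m' + (cost t x u)%:E + accr_mem x m' m u).
Proof. by move=> tT; rewrite /Lambda /Theta -(subnSK tT). Qed.

Lemma Qhat_end (p : P T) u :
  Qhat p u = \big[maxe/-oo]_(x : X)
    ((cost T x u)%:E
     + accr (accrued T) (state T) (fun w => (info_var T w, action T w))
            x (p, u)).
Proof. by rewrite /Qhat subnn. Qed.

Lemma Qhat_step t (p : P t) u : (t < T)%N ->
  Qhat p u = \big[maxe/-oo]_(x : X) \big[maxe/-oo]_(p' <- infos t.+1)
    (Vhat p' + (cost t x u)%:E
     + accr (accrued t) (state_info t)
            (fun w => (info_var t w, action t w)) (x, p') (p, u)).
Proof. by move=> tT; rewrite /Vhat /Qhat -(subnSK tT). Qed.

Lemma alpha_end eps : alpha eps T = ((lip_cost T + 1) * eps T)%R.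
Proof. by rewrite /alpha subnn. Qed.

Lemma alpha_step eps t : (t < T)%N ->
  alpha eps t = (alpha eps t.+1 + (2 * lip_step t + 1) * eps t)%R.
Proof. by move=> tT; rewrite /alpha -(subnSK tT). Qed.

End System.

(* Main.v *)
Require Import Defs.
From HB Require Import structures.
From mathcomp Require Import all_boot all_order all_algebra finmap.
From mathcomp Require Import all_classical all_reals all_analysis.
From mathcomp Require Import lra.

Set Implicit Arguments.
Unset Strict Implicit.
Unset Printing Implicit Defensive.

Import Order.TTheory GRing.Theory Num.Theory.
Local Open Scope ring_scope.
Local Open Scope ereal_scope.

(** The reason the bound holds is that every dynamic program involved is a
    worst-case conditional expectation. For a cost C, an observed variable Y
    and a payoff H on the sample space, put

      E[H | y] = max over {Y = y} of (H + C)  -  max over {Y = y} of C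

    ([cond_max]). Maximizing G x + r(x | y) over x, where r is the accrued
    distribution of X, gives exactly E[G(X) | y] ([bigmax_accrE]): the maximum
    over x, of maxima over {Y = y, X = x}, is one maximum over {Y = y}. Hence
    the value of one step does not depend on which variable is used to index
    the maximization: the pair (x_t, m_(t+1)) of the memory-based recursion
    and the pair (x_t, hat pi_(t+1)) of the approximate one give the same
    thing once the payoff is the same function of the sample point.

    Three estimates on E[. | .] then suffice. It is nonexpansive in the payoff
    for the supremum norm ([cond_max_close]). Replacing the condition m by
    sigma m costs at most (L + 1) eps for an L-Lipschitz payoff, since points
    of the two conditional ranges can be matched within eps with accrued
    distributions differing by at most eps ([cond_max_accr_dist]). Finally,
    conditioning also on the current action is harmless for quantities fixed
    before it is taken ([cond_max_refine]), which reconciles the terminal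
    values r(x | m) and r(x | m, u).

    The approximate value Qhat at sigma m is the pivot: by backward induction
    both Q and Theta stay within alpha_t of it ([Q_Theta_Qhat_close]). At a
    step, both have a continuation value within alpha_(t+1) of that of
    Qhat, which is Vhat at sigma m_(t+1): V because a minimum is nonexpansive,
    Lambda because the chosen action attains the minimum defining Vhat.
    Replacing the continuation value by Vhat costs alpha_(t+1), and
    then replacing m by sigma m costs (2 L_t + 1) eps_t, the payoff c_t + Vhat
    being 2 L_t-Lipschitz for the maximum metric ([memory_step_close]). The
    triangle inequality between Q and Theta gives 2 alpha_t.

    Values are extended reals; a bound of |x - y| by a real number also says
    that x and y are finite, so finiteness propagates with the bounds. *)

(** * Closeness of extended reals *)

(** If x or y is infinite, then so is |x - y|, even for x = y: the difference
    of equal infinities is -oo. *)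
Lemma close_finP (R : realType) (x y : \bar R) (d : R) :
  reflect (exists a b : R, [/\ x = a%:E, y = b%:E & (`|a - b| <= d)%R])
          (`|x - y| <= d%:E).
Proof.
apply: (iffP idP) => [|[a [b [-> -> abd]]]]; last by rewrite -EFinB lee_fin.
by case: x y => [a||] [b||] //=; rewrite lee_fin => abd; exists a, b.
Qed.

Lemma close_sym (R : realType) (x y : \bar R) (d : R) :
  `|x - y| <= d%:E -> `|y - x| <= d%:E.
Proof.
move=> /close_finP[a [b [-> -> abd]]].
by apply/close_finP; exists b, a; rewrite distrC.
Qed.

Lemma close_trans (R : realType) (x y z : \bar R) (d e : R) :
  `|x - y| <= d%:E -> `|y - z| <= e%:E -> `|x - z| <= (d + e)%:E.
Proof.
move=> /close_finP[a [b [-> -> abd]]] /close_finP[b' [c [[<-] -> bce]]].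
apply/close_finP; exists a, c; split=> //.
by rewrite (le_trans (ler_distD b _ _))// lerD.
Qed.

Lemma closeD (R : realType) (x y x' y' : \bar R) (d e : R) :
  `|x - y| <= d%:E -> `|x' - y'| <= e%:E ->
  `|x + x' - (y + y')| <= (d + e)%:E.
Proof.
move=> /close_finP[a [b [-> -> abd]]] /close_finP[a' [b' [-> -> abe]]].
apply/close_finP; exists (a + a')%R, (b + b')%R; split=> //.
by rewrite opprD addrACA (le_trans (ler_normD _ _))// lerD.
Qed.

Lemma close_refl (R : realType) (x : \bar R) :
  x \is a fin_num -> `|x - x| <= 0%:E.
Proof. by move=> xfin; rewrite subee// abse0. Qed.

Lemma bigmaxe_attained (R : realType) (I : eqType) (r : seq I) (P : pred I)
    (F : I -> \bar R) (i : I) : i \in r -> P i ->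
  exists j, [/\ j \in r, P j & \big[maxe/-oo]_(k <- r | P k) F k = F j].
Proof.
elim: r i => // k r IH i; rewrite inE big_cons => ir Pi.
have [/hasP[j jr Pj]|/hasPn rN] := boolP (has P r).
  have [l [lr Pl ->]] := IH j jr Pj.
  case: ifPn => [Pk|_]; last by exists l; split; rewrite // inE lr orbT.
  rewrite /maxe; case: ifPn => _; last by exists k; rewrite mem_head.
  by exists l; split; rewrite // inE lr orbT.
have -> : \big[maxe/-oo]_(k <- r | P k) F k = -oo.
  by rewrite big_seq_cond big1_idem// => l /andP[/rN/negPf->].
case/predU1P: ir => [<-|/rN]; last by rewrite Pi.
by rewrite Pi; exists i; rewrite mem_head maxeNy.
Qed.

(** A Hausdorff-type matching of the two index sets is enough to compare the
    maxima; it covers both a change of the summand over a fixed index set and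
    a change of the set over which a Lipschitz function is maximized. *)
Lemma bigmaxe_close (R : realType) (I J : eqType) (r : seq I) (s : seq J)
    (P : pred I) (Q : pred J) (F : I -> \bar R) (G : J -> \bar R) (d : R) :
  (exists2 i, i \in r & P i) ->
  (forall i, i \in r -> P i ->
     exists j, [/\ j \in s, Q j & `|F i - G j| <= d%:E]) ->
  (forall j, j \in s -> Q j ->
     exists i, [/\ i \in r, P i & `|F i - G j| <= d%:E]) ->
  `|\big[maxe/-oo]_(i <- r | P i) F i - \big[maxe/-oo]_(j <- s | Q j) G j|
    <= d%:E.
Proof.
move=> [i ir Pi] FG GF.
(* The maximum of F, at i1, is bounded through a match j2 by that of G, at j1,
   and conversely through a match i2 of j1. *)
have [i1 [i1r Pi1 Fi1]] := bigmaxe_attained F ir Pi.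
have [j2 [j2s Qj2 /close_finP[a [b [ea eb abd]]]]] := FG _ i1r Pi1.
have [j1 [j1s Qj1 Gj1]] := bigmaxe_attained G j2s Qj2.
have [i2 [i2r Pi2 /close_finP[a' [b' [ea' eb' abd']]]]] := GF _ j1s Qj1.
have := le_bigmax_seq -oo i2 P F i2r Pi2.
have := le_bigmax_seq -oo j2 Q G j2s Qj2.
rewrite {}Fi1 {}Gj1 ea eb ea' eb' -EFinB !lee_fin => bb' aa'.
move: abd abd'; rewrite !ler_norml => /andP[_ h1] /andP[h2 _]; lra.
Qed.

Lemma bigmine_close (R : realType) (I : finType) (i0 : I)
    (F G : I -> \bar R) (d : R) :
  (forall i, `|F i - G i| <= d%:E) ->
  `|\big[mine/+oo]_i F i - \big[mine/+oo]_i G i| <= d%:E.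
Proof.
have minE (H : I -> \bar R) :
      \big[mine/+oo]_(i : I) H i = - \big[maxe/-oo]_(i : I) - H i.
  by elim/big_rec2: _ => // i x y _ ->; rewrite oppe_max oppeK.
move=> FG; rewrite !minE.
have oFG i : `|- F i - - G i| <= d%:E.
  have /close_finP[a [b [-> -> ?]]] := FG i.
  by apply/close_finP; exists (- a)%R, (- b)%R; rewrite -opprD normrN.
have /close_finP[a [b [-> -> ?]]] :
    `|\big[maxe/-oo]_i - F i - \big[maxe/-oo]_i - G i| <= d%:E.
  apply: bigmaxe_close => [|i _ _|i _ _]; first by exists i0.
  - by exists i.
  - by exists i.
by apply/close_finP; exists (- a)%R, (- b)%R; rewrite -opprD normrN.
Qed.

(** * Accrued distributions and worst-case conditional expectation *)

(** The max-plus analogue of a conditional expectation given Y = y: the prior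
    weight of w is C w, and subtracting the maximum of C over {Y = y}
    normalizes it. *)
Definition cond_max (R : realType) (Om : finType) (B : choiceType)
    (C : Om -> R) (Y : Om -> B) (y : B) (H : Om -> \bar R) : \bar R :=
  \big[maxe/-oo]_(w | Y w == y) (H w + (C w)%:E)
  - \big[maxe/-oo]_(w | Y w == y) (C w)%:E.

Section AccruedDistribution.
Context (R : realType) (Om : finType).
Implicit Types A B : choiceType.

Lemma vrangeP A (X : Om -> A) (x : A) :
  reflect (exists w, X w = x) (x \in vrange X).
Proof.
apply: (iffP (imfsetP _ _ _ _)) => [[w _ ->]|[w <-]]; first by exists w.
by exists w.
Qed.

Lemma crangeP A B (X : Om -> A) (Y : Om -> B) (x : A) (y : B) :
  reflect (exists2 w, Y w = y & X w = x) (x \in crange X Y y).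
Proof.
apply: (iffP (imfsetP _ _ _ _)) => [[w]|[w yw <-]].
  by rewrite inE => /eqP ? ->; exists w.
by exists w; rewrite // inE; apply/eqP.
Qed.

Lemma bigmax_indic A B (C : Om -> R) (X : Om -> A) (Y : Om -> B) (x : A)
    (y : B) :
  \big[maxe/-oo]_(a <- vrange C)
     (a%:E + Defs.indic (fun w => (X w, C w)) Y (x, a) y)
  = \big[maxe/-oo]_(w | (Y w == y) && (X w == x)) (C w)%:E.
Proof.
apply/eqP; rewrite eq_le; apply/andP; split.
  rewrite big_seq; apply: bigmax_le => [|a _]; first exact: leNye.
  rewrite /Defs.indic; case: crangeP => [[w yw [xw <-]]|_].
    rewrite addr0; apply: le_bigmax_cond; rewrite yw xw !eqxx//.
  by rewrite addeNy leNye.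
apply: bigmax_le => [|w /andP[/eqP yw /eqP xw]]; first exact: leNye.
apply: (@bigmax_sup_seq _ _ _ _ _ (C w)) => //.
  by apply/vrangeP; exists w.
rewrite /Defs.indic ifT ?addr0//.
by apply/crangeP; exists w; rewrite // xw.
Qed.

Lemma accrE A B (C : Om -> R) (X : Om -> A) (Y : Om -> B) (x : A) (y : B) :
  accr C X Y x y =
  \big[maxe/-oo]_(w | (Y w == y) && (X w == x)) (C w)%:E
  - \big[maxe/-oo]_(w | Y w == y) (C w)%:E.
Proof.
rewrite /accr bigmax_indic; congr (_ - _).
(* The subtracted term is the numerator for a constant variable. *)
have := bigmax_indic C (fun=> tt) Y tt y.
under [RHS]eq_bigl do rewrite andbT.
move=> <-; apply: eq_bigr => a _; congr (_ + _); rewrite /Defs.indic.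
congr (if _ then _ else _).
by apply/crangeP/crangeP => -[w yw]; [move=> <-|case=> <-]; exists w.
Qed.

(** The analogue of computing the expectation of G(X) from the law of X.
    As -oo absorbs +oo, addition is associative and distributes over maxima on
    all extended reals, so G may take infinite values. *)
Lemma bigmax_accrE A B (C : Om -> R) (X : Om -> A) (Y : Om -> B) (y : B)
    (s : seq A) (G : A -> \bar R) :
  (forall w, Y w = y -> X w \in s) ->
  \big[maxe/-oo]_(x <- s) (G x + accr C X Y x y)
  = cond_max C Y y (fun w => G (X w)).
Proof.
move=> sX; rewrite /cond_max; set K := \big[maxe/-oo]_(w | Y w == y) (C w)%:E.
have accrG x : G x + accr C X Y x y =
    \big[maxe/-oo]_(w | (Y w == y) && (X w == x)) (G x + (C w)%:E) - K.
  rewrite accrE -/K addeA; congr (_ - _).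
  by rewrite (big_morph _ (adde_maxr (G x)) (addeNy _)).
apply/eqP; rewrite eq_le; apply/andP; split.
  apply: bigmax_le => [|x _]; first exact: leNye.
  rewrite accrG leeD2r//; apply: bigmax_le => [|w /andP[yw /eqP <-]].
    exact: leNye.
  exact: (le_bigmax_cond -oo (fun w => G (X w) + (C w)%:E)).
rewrite (big_morph (fun z => z - K)
  (fun a b : \bar R => adde_maxl a b (- K)) (addNye _)).
apply: bigmax_le => [|w yw]; first exact: leNye.
apply: (@bigmax_sup_seq _ _ _ _ _ (X w)) => //.
  by apply: sX; apply/eqP.
rewrite accrG leeD2r//.
apply: (le_bigmax_cond -oo (fun w' => G (X w) + (C w')%:E)).
by rewrite yw /=.
Qed.

Lemma bigmaxe_fin_num_cond (P : pred Om) w (C : Om -> R) : P w ->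
  \big[maxe/-oo]_(v | P v) (C v)%:E \is a fin_num.
Proof.
move=> Pw.
by have [v [_ _ ->]] :=
  bigmaxe_attained (fun v => (C v)%:E) (mem_index_enum w) Pw.
Qed.

Lemma cond_max_close B (C : Om -> R) (Y : Om -> B) (y : B) (H H' : Om -> \bar R)
    (d : R) :
  y \in vrange Y -> (forall w, Y w = y -> `|H w - H' w| <= d%:E) ->
  `|cond_max C Y y H - cond_max C Y y H'| <= d%:E.
Proof.
move=> /vrangeP[w0 yw0] HH'; rewrite /cond_max.
have ne : exists2 w, w \in index_enum Om & Y w == y.
  by exists w0; [exact: mem_index_enum|apply/eqP].
rewrite -[d]addr0; apply: closeD; last first.
  apply: close_refl; rewrite fin_numN; case: ne => w _.
  exact: bigmaxe_fin_num_cond.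
have HC w : Y w = y -> `|H w + (C w)%:E - (H' w + (C w)%:E)| <= d%:E.
  move=> yw; rewrite -[d]addr0; apply: closeD; first exact: HH'.
  exact: close_refl.
by apply: bigmaxe_close => // w _ /eqP yw; exists w;
  rewrite mem_index_enum yw eqxx; split=> //; exact: HC.
Qed.

(** Further conditioning on Z = z changes nothing when every sample point can
    be moved into {Z = z} without affecting Y, H and C: neither of the two
    maxima loses a value. *)
Lemma cond_max_refine (B D : choiceType) (C : Om -> R) (Y : Om -> B)
    (Z : Om -> D) (y : B) (z : D) (H : Om -> \bar R) :
  (forall w, Y w = y ->
     exists w', [/\ Y w' = y, Z w' = z, H w' = H w & C w' = C w]) ->
  cond_max C (fun w => (Y w, Z w)) (y, z) H = cond_max C Y y H.
Proof.
move=> ref.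
have eqmax (G : Om -> \bar R) :
    (forall w w', H w' = H w -> C w' = C w -> G w' = G w) ->
    \big[maxe/-oo]_(w | (Y w, Z w) == (y, z)) G w
    = \big[maxe/-oo]_(w | Y w == y) G w.
  move=> GHC; apply/eqP; rewrite eq_le; apply/andP; split.
    apply: bigmax_le => [|w /eqP[yw _]]; first exact: leNye.
    by apply: le_bigmax_cond; apply/eqP.
  apply: bigmax_le => [|w /eqP yw]; first exact: leNye.
  have [w' [yw' zw' Hw' Cw']] := ref w yw.
  rewrite -(GHC w w')//; apply: (le_bigmax_cond -oo G).
  by rewrite yw' zw'.
by rewrite /cond_max !eqmax// => w w' Hw Cw; rewrite ?Hw Cw.
Qed.

End AccruedDistribution.

(** * Distances and Lipschitz constants *)

(** The part of the metric axioms that the estimates rely on; the last clause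
    combines nonnegativity and separation for distinct points. *)
Definition is_distance (R : realType) (A : Type) (d : A -> A -> R) : Prop :=
  [/\ forall x, d x x = 0%R, forall x y, d x y = d y x &
      forall x y, (d x y <= 0)%R -> x = y].

Lemma mdist_is_distance (R : realType) (M : metricType R) :
  is_distance (@mdist R M).
Proof.
split=> [x|x y|x y]; [exact: mdistxx|exact: metric_sym|].
by rewrite leNgt mdist_gt0 negbK => /eqP.
Qed.

Lemma maxdist_is_distance (R : realType) (A B : Type) (dA : A -> A -> R)
    (dB : B -> B -> R) :
  is_distance dA -> is_distance dB -> is_distance (maxdist dA dB).
Proof.
move=> [rA sA pA] [rB sB pB]; split.
- by move=> x; rewrite /maxdist rA rB maxxx.
- by move=> x y; rewrite /maxdist sA sB.
- move=> [a b] [a' b']; rewrite /maxdist /= ge_max => /andP[/pA -> /pB ->//].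
Qed.

Lemma lip_const_ge0 (R : realType) (A : choiceType) (d : A -> A -> R)
    (D : {fset A}) (F : A -> R) : (0 <= lip_const d D F)%R.
Proof. exact: bigmax_ge_id. Qed.

Lemma lip_constP (R : realType) (A : choiceType) (d : A -> A -> R)
    (D : {fset A}) (F : A -> R) (p q : A) :
  is_distance d -> p \in D -> q \in D ->
  (`|F p - F q| <= lip_const d D F * d p q)%R.
Proof.
move=> [d0 _ dpos] pD qD.
have [->|pq] := eqVneq p q; first by rewrite d0 mulr0 subrr normr0.
have dpq : (0 < d p q)%R.
  by rewrite ltNge; apply/negP => /dpos/eqP; rewrite (negPf pq).
rewrite -ler_pdivrMr// /lip_const.
apply: (@bigmax_sup_seq _ _ _ _ _ p) => //.
exact: (@bigmax_sup_seq _ _ _ _ _ q).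
Qed.

(** * Sensitivity to the conditioning variable *)

Section AccruedDistance.
Context (R : realType) (Om : finType).

Lemma hausdorff_argmin (A : choiceType) (d : A -> A -> R) (D E : {fset A})
    (psi : A -> A) (e : R) x :
  is_distance d -> argmin_selection d E psi ->
  \big[maxe/-oo]_(x <- D) \big[mine/+oo]_(y <- E) (d x y)%:E <= e%:E ->
  x \in D -> (d x (psi x) <= e)%R.
Proof.
move=> [_ dsym _] psiE DE xD; rewrite -lee_fin; apply: le_trans DE.
apply: (@bigmax_sup_seq _ _ _ _ _ x) => //.
rewrite big_seq; apply: le_bigmin => [|y yE]; first exact: leey.
by rewrite lee_fin dsym [leRHS]dsym; case: (psiE x) => _; apply.
Qed.

Lemma argmin_selection_id (A : choiceType) (d : A -> A -> R) (D : {fset A})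
    (psi : A -> A) x :
  is_distance d -> argmin_selection d D psi -> x \in D -> psi x = x.
Proof.
move=> [d0 _ dpos] psiD xD; apply: dpos.
by rewrite -(d0 x); case: (psiD x) => _; apply.
Qed.

(** A point x of one conditional range is matched with its projection on the
    other one. The projection is within e of x by the Hausdorff part of the
    distance, so G moves by at most L e; the accrued distributions at the two
    points differ by at most e by the other part, since x is its own
    projection on the range to which it belongs. *)
Lemma cond_max_accr_dist (A B1 B2 : choiceType) (d : A -> A -> R)
    (C : Om -> R) (X : Om -> A) (Y : Om -> B1) (y : B1) (psiy : A -> A)
    (Z : Om -> B2) (z : B2) (psiz : A -> A) (G : A -> \bar R) (L e : R) :
  is_distance d ->
  argmin_selection d (crange X Y y) psiy ->
  argmin_selection d (crange X Z z) psiz ->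
  y \in vrange Y -> (0 <= L)%R ->
  (forall x x', x \in crange X Y y -> x' \in crange X Z z ->
     `|G x - G x'| <= (L * d x x')%:E) ->
  accr_dist d C X Y y psiy Z z psiz <= e%:E ->
  `|cond_max C Y y (fun w => G (X w)) - cond_max C Z z (fun w => G (X w))|
    <= ((L + 1) * e)%:E.
Proof.
move=> dd psiyP psizP /vrangeP[w0 yw0] L0 GL.
rewrite /accr_dist /hausdorff_dist !ge_max => /andP[/andP[hYZ hZY] hr].
rewrite mulrDl mul1r.
have hr' x : x \in crange X Y y \/ x \in crange X Z z ->
    `|accr C X Y (psiy x) y - accr C X Z (psiz x) z| <= e%:E.
  move=> xYZ; apply: le_trans hr.
  apply: (@le_bigmax_seq _ _ _ _ _ x) => //.
  by rewrite in_fsetE; apply/orP.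
rewrite -(@bigmax_accrE _ _ _ _ C X Y y (crange X Y y)); last first.
  by move=> w yw; apply/crangeP; exists w.
rewrite -(@bigmax_accrE _ _ _ _ C X Z z (crange X Z z)); last first.
  by move=> w zw; apply/crangeP; exists w.
have GLe x x' : x \in crange X Y y -> x' \in crange X Z z ->
    (d x x' <= e)%R -> `|G x - G x'| <= (L * e)%:E.
  move=> xY xZ dxx; apply: le_trans (GL _ _ xY xZ) _.
  by rewrite lee_fin ler_wpM2l.
have [_ dsym _] := dd.
apply: bigmaxe_close => [|x xY _|x xZ _].
- by exists (X w0) => //; apply/crangeP; exists w0.
- have xZ : psiz x \in crange X Z z by case: (psizP x).
  exists (psiz x); split=> //; apply: closeD.
    exact/GLe/(hausdorff_argmin dd psizP hYZ).
  by have := hr' x (or_introl xY); rewrite (argmin_selection_id dd psiyP xY).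
- have xY : psiy x \in crange X Y y by case: (psiyP x).
  exists (psiy x); split=> //; apply: closeD.
    apply: GLe => //; rewrite dsym; apply: (hausdorff_argmin dd psiyP _ xZ).
    by move: hZY; under eq_bigr do under eq_bigr do rewrite dsym.
  by have := hr' x (or_intror xZ); rewrite (argmin_selection_id dd psizP xZ).
Qed.

End AccruedDistance.

(** * The controlled system *)

Section ApproximateInformationState.
Context (R : realType) (S : metricType R) (sys : system S).
Local Notation T := (horizon sys).
Local Notation X := (states sys).
Local Notation U := (actions sys).

Lemma state_dist_is_distance : is_distance (@state_dist R S sys).
Proof.
have [d0 dsym dpos] := mdist_is_distance S.
by split=> [x|x y|x y /dpos/val_inj//]; rewrite /state_dist.
Qed.

Lemma action_dist_is_distance : is_distance (@action_dist R S sys).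
Proof.
have [d0 dsym dpos] := mdist_is_distance S.
by split=> [x|x y|x y /dpos/val_inj//]; rewrite /action_dist.
Qed.

Lemma cost_lip t (x x' : X) (u : U) :
  (`|cost t x u - cost t x' u| <= lip_cost sys t * state_dist x x')%R.
Proof.
have dd := maxdist_is_distance state_dist_is_distance action_dist_is_distance.
have := lip_constP (D := [fset p | p : (X * U)%type]%fset)
  (fun p => cost t p.1 p.2) dd (p := (x, u)) (q := (x', u)).
rewrite !in_fsetE => /(_ isT isT) /=.
rewrite {2}/maxdist /=; have [-> _ _] := action_dist_is_distance.
by rewrite max_l// /state_dist mdist_ge0.
Qed.

(** Redirecting the action at time t: actions are free coordinates of the
    sample space, and nothing up to and including the observation at time t
    depends on this one. *)
Definition set_action (t : nat) (u : U) (w : sample sys) : sample sys :=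
  (w.1, [ffun i => if i == inord t then u else w.2 i]).

Lemma action_set t u w : action t (set_action t u w) = u.
Proof. by rewrite /action ffunE eqxx. Qed.

Lemma action_set_before s t u w : (s < t)%N -> (t <= T)%N ->
  action s (set_action t u w) = action s w.
Proof.
move=> st tT; rewrite /action ffunE ifN// -val_eqE /= !inordK ?ltn_eqF//.
exact: leq_trans st (leq_trans tT _).
Qed.

Lemma state_set s t u w : (s <= t)%N -> (t <= T)%N ->
  state s (set_action t u w) = state s w.
Proof.
elim: s => //= s IH st tT; rewrite IH ?(ltnW st)//.
by rewrite action_set_before.
Qed.

Lemma mem_var_set t u w : (t <= T)%N ->
  mem_var t (set_action t u w) = mem_var t w.
Proof.
move=> tT; congr (_, _); apply/ffunP => i; rewrite !ffunE.
  by rewrite /observation state_set// -ltnS.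
by rewrite action_set_before.
Qed.

Lemma accrued_set t u w : (t <= T)%N ->
  accrued t (set_action t u w) = accrued t w.
Proof.
move=> tT; apply: eq_bigr => i _.
by rewrite state_set ?(ltnW (ltn_ord i))// action_set_before.
Qed.

Lemma memories_action t (m : memory sys t) u : (t <= T)%N ->
  m \in memories sys t ->
  (m, u) \in vrange (fun w => (mem_var t w, action t w)).
Proof.
move=> tT /vrangeP[w <-]; apply/vrangeP; exists (set_action t u w).
by rewrite mem_var_set// action_set.
Qed.

Context {P : nat -> metricType R} (sigma : forall t, memory sys t -> P t).

Lemma infosP t (p : P t) :
  reflect (exists2 m, m \in memories sys t & sigma m = p) (p \in infos sigma t).
Proof.
apply: (iffP (vrangeP _ _)) => [[w <-]|[_ /vrangeP[w <-] <-]].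
  by exists (mem_var t w) => //; apply/vrangeP; exists w.
by exists w.
Qed.

(** ** The dynamic programs as conditional expectations *)

Lemma Q_end_cond_max (m : memory sys T) u :
  Q m u = cond_max (accrued T) (mem_var T) m
            (fun w => (cost T (state T w) u)%:E).
Proof.
rewrite Q_end (bigmax_accrE _ (fun x => (cost T x u)%:E))// => w _.
exact: mem_index_enum.
Qed.

Lemma Theta_end_cond_max g (m : memory sys T) u :
  Theta g m u = cond_max (accrued T) (mem_var T) m
                  (fun w => (cost T (state T w) u)%:E).
Proof.
rewrite Theta_end (bigmax_accrE _ (fun x => (cost T x u)%:E)); last first.
  by move=> w _; exact: mem_index_enum.
apply: cond_max_refine => w mw; exists (set_action T u w).
by rewrite mem_var_set// action_set state_set// accrued_set.
Qed.

Lemma Qhat_end_cond_max (p : P T) u :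
  Qhat sigma p u = cond_max (accrued T) (info_var sigma T) p
                     (fun w => (cost T (state T w) u)%:E).
Proof.
rewrite Qhat_end (bigmax_accrE _ (fun x => (cost T x u)%:E)); last first.
  by move=> w _; exact: mem_index_enum.
apply: cond_max_refine => w mw; exists (set_action T u w).
by rewrite /info_var mem_var_set// action_set state_set// accrued_set.
Qed.

(** The payoff on the right is a function of the sample point only. For
    F m' = Vhat (sigma m'), it is therefore also the payoff of the approximate
    recursion, although that one maximizes over information states. *)
Lemma memory_step_cond_max t (m : memory sys t) u
    (F : memory sys t.+1 -> \bar R) :
  \big[maxe/-oo]_(x : X) \big[maxe/-oo]_(m' <- memories sys t.+1)
    (F m' + (cost t x u)%:E + accr_mem x m' m u)
  = cond_max (accrued t) (fun w => (mem_var t w, action t w)) (m, u)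
      (fun w => F (mem_var t.+1 w) + (cost t (state t w) u)%:E).
Proof.
pose H q := F q.2 + (cost t q.1 u)%:E + accr_mem q.1 q.2 m u.
rewrite -(big_allpairs (F := H)) /H.
rewrite -(bigmax_accrE _ (X := fun w => (state t w, mem_var t.+1 w))
  (s := [seq (x, m') | x <- index_enum X, m' <- memories sys t.+1])
  (fun q => F q.2 + (cost t q.1 u)%:E)).
  by apply: eq_bigr => -[x m'] _.
move=> w _; apply: allpairs_f; first exact: mem_index_enum.
by apply/vrangeP; exists w.
Qed.

Lemma Qhat_step_cond_max t (p : P t) u : (t < T)%N ->
  Qhat sigma p u =
  cond_max (accrued t) (fun w => (info_var sigma t w, action t w)) (p, u)
    (fun w => Vhat sigma (info_var sigma t.+1 w)
              + (cost t (state t w) u)%:E).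
Proof.
move=> tT; rewrite Qhat_step//.
pose H q := Vhat sigma q.2 + (cost t q.1 u)%:E +
  accr (accrued t) (state_info sigma t)
    (fun w => (info_var sigma t w, action t w)) q (p, u).
rewrite -(bigmax_accrE _ (X := state_info sigma t)
  (s := [seq (x, p') | x <- index_enum X, p' <- infos sigma t.+1])
  (fun q => Vhat sigma q.2 + (cost t q.1 u)%:E)).
  by rewrite (big_allpairs (F := H)).
move=> w _; apply: allpairs_f; first exact: mem_index_enum.
by apply/vrangeP; exists w.
Qed.

(** The factor 2 comes from adding the cost and the continuation value, each
    of them lip_step-Lipschitz for the maximum metric. *)
Lemma step_value_lip t u (q q' : X * P t.+1) :
  (forall p, p \in infos sigma t.+1 -> Vhat sigma p \is a fin_num) ->
  q.2 \in infos sigma t.+1 -> q'.2 \in infos sigma t.+1 ->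
  `|Vhat sigma q.2 + (cost t q.1 u)%:E - (Vhat sigma q'.2 + (cost t q'.1 u)%:E)|
    <= (2 * lip_step sigma t * state_info_dist q q')%:E.
Proof.
move=> Vfin qI qI'; set L := lip_step sigma t; set D := state_info_dist q q'.
have D0 : (0 <= D)%R by rewrite /D /state_info_dist le_max mdist_ge0.
rewrite -mulrA mulr_natl mulr2n; apply: closeD.
  apply/close_finP; exists (fine (Vhat sigma q.2)), (fine (Vhat sigma q'.2)).
  rewrite !fineK ?Vfin//; split=> //.
  apply: le_trans (lip_constP (fun p => fine (Vhat sigma p))
    (mdist_is_distance _) qI qI') _.
  rewrite ler_pM ?lip_const_ge0 ?mdist_ge0//.
    by rewrite /L /lip_step le_max lexx.
  by rewrite /D /state_info_dist le_max lexx orbT.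
rewrite -EFinB lee_fin; apply: le_trans (cost_lip _ _ _ _) _.
rewrite ler_pM ?lip_const_ge0 ?mdist_ge0//.
  by rewrite /L /lip_step le_max lexx orbT.
by rewrite /D /state_info_dist le_max lexx.
Qed.

(** ** Error of one step and backward induction *)

Context (psi : selections sigma) (eps : nat -> R).
Hypothesis ais : approx_info_states psi eps.

Lemma end_close (m : memory sys T) u : m \in memories sys T ->
  `|cond_max (accrued T) (mem_var T) m (fun w => (cost T (state T w) u)%:E)
    - Qhat sigma (sigma m) u| <= ((lip_cost sys T + 1) * eps T)%:E.
Proof.
move=> mM; rewrite Qhat_end_cond_max; have [_ _ aisT] := ais.
apply: (cond_max_accr_dist (G := fun x => (cost T x u)%:E)
  state_dist_is_distance (sel_mem_endP psi mM) _ mM _ _ (aisT m mM)).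
- by apply: sel_info_endP; apply/infosP; exists m.
- exact: lip_const_ge0.
- by move=> x x' _ _; rewrite -EFinB lee_fin cost_lip.
Qed.

(** One backward step for an arbitrary continuation value F, so that it serves
    both V and Lambda. Passing from F to Vhat costs a, because the conditional
    expectation is nonexpansive; passing from m to sigma m costs
    (2 L_t + 1) eps_t by the Lipschitz estimate. The closeness of F to Vhat
    also provides the finiteness of Vhat on which that estimate depends. *)
Lemma memory_step_close t (m : memory sys t) u
    (F : memory sys t.+1 -> \bar R) (a : R) :
  (t < T)%N -> m \in memories sys t ->
  (forall m', m' \in memories sys t.+1 ->
     `|F m' - Vhat sigma (sigma m')| <= a%:E) ->
  `|\big[maxe/-oo]_(x : X) \big[maxe/-oo]_(m' <- memories sys t.+1)
      (F m' + (cost t x u)%:E + accr_mem x m' m u)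
    - Qhat sigma (sigma m) u|
  <= (a + (2 * lip_step sigma t + 1) * eps t)%:E.
Proof.
move=> tT mM FV; have [_ aist _] := ais.
have Vfin p : p \in infos sigma t.+1 -> Vhat sigma p \is a fin_num.
  by move=> /infosP[m' m'M <-]; have /close_finP[? [? [_ -> _]]] := FV _ m'M.
have memM w : mem_var t.+1 w \in memories sys t.+1 by apply/vrangeP; exists w.
have muM := memories_action u (ltnW tT) mM.
rewrite memory_step_cond_max Qhat_step_cond_max//.
(* Change the payoff first, keeping the condition m, and then the condition. *)
apply: (close_trans (y := cond_max (accrued t)
  (fun w => (mem_var t w, action t w)) (m, u)
  (fun w => Vhat sigma (sigma (mem_var t.+1 w)) + (cost t (state t w) u)%:E))).
  apply: (cond_max_close _ muM) => w _; rewrite -[a]addr0; apply: closeD.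
    exact: FV (memM w).
  exact: close_refl.
have stI (B : choiceType) (Y : sample sys -> B) y x :
    x \in crange (state_info sigma t) Y y -> x.2 \in infos sigma t.+1.
  by move=> /crangeP[w _ <-]; apply/vrangeP; exists w.
apply: (cond_max_accr_dist (X := state_info sigma t)
  (G := fun q => Vhat sigma q.2 + (cost t q.1 u)%:E)
  _ (sel_memP psi u tT mM) _ muM _ _ (aist t m u tT mM)).
- exact: maxdist_is_distance state_dist_is_distance (mdist_is_distance _).
- by apply: sel_infoP => //; apply/infosP; exists m.
- by rewrite mulr_ge0// /lip_step le_max lip_const_ge0.
- by move=> x x' xM xI; apply: step_value_lip => //;
    [apply: stI xM|apply: stI xI].
Qed.

Context (ghat : forall t, P t -> U).
Hypothesis ghat_min : forall t (p : P t), (t <= T)%N -> p \in infos sigma t ->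
  forall u, Qhat sigma p (ghat p) <= Qhat sigma p u.

Lemma Vhat_ghat t (p : P t) : (t <= T)%N -> p \in infos sigma t ->
  Vhat sigma p = Qhat sigma p (ghat p).
Proof.
move=> tT pI; apply/eqP; rewrite eq_le bigmin_le_cond//=.
by apply: le_bigmin => [|u _]; [exact: leey|exact: ghat_min].
Qed.

Let g t (m : memory sys t) := ghat (sigma m).

Lemma V_Vhat_close t (m : memory sys t) (a : R) :
  (forall u, `|Q m u - Qhat sigma (sigma m) u| <= a%:E) ->
  `|V m - Vhat sigma (sigma m)| <= a%:E.
Proof.
move=> QQ; have [u0 u0U] := fset0Pn _ (actions_neq0 sys).
exact: (bigmine_close (FSetSub u0U)).
Qed.

Lemma Lambda_Vhat_close t (m : memory sys t) (a : R) :
  (t <= T)%N -> m \in memories sys t ->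
  (forall u, `|Theta g m u - Qhat sigma (sigma m) u| <= a%:E) ->
  `|Lambda g m - Vhat sigma (sigma m)| <= a%:E.
Proof.
by move=> tT mM QQ; rewrite Vhat_ghat//; [exact: QQ|apply/infosP; exists m].
Qed.

(** Comparing both programs to Qhat rather than to each other is what makes the
    induction go through: the approximation property only relates
    conditioning on m to conditioning on sigma m. *)
Lemma Q_Theta_Qhat_close k t (m : memory sys t) u :
  (t + k)%N = T -> m \in memories sys t ->
  `|Q m u - Qhat sigma (sigma m) u| <= (alpha sigma eps t)%:E /\
  `|Theta g m u - Qhat sigma (sigma m) u| <= (alpha sigma eps t)%:E.
Proof.
elim: k t m u => [|k IH] t m u.
  rewrite addn0 => tT; move: m u; rewrite tT => m u mM.
  rewrite Q_end_cond_max Theta_end_cond_max alpha_end.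
  by split; exact: end_close.
rewrite addnS -addSn => tkT mM.
have tT : (t < T)%N by rewrite -tkT leq_addr.
have Qm' m' u' := IH t.+1 m' u' tkT.
rewrite Q_step// Theta_step// alpha_step//; split.
  under eq_bigr do under eq_bigr do rewrite (addeC _ (V _)).
  apply: memory_step_close => // m' m'M.
  by apply: V_Vhat_close => u'; case: (Qm' m' u' m'M).
apply: memory_step_close => // m' m'M.
by apply: Lambda_Vhat_close => // u'; case: (Qm' m' u' m'M).
Qed.

End ApproximateInformationState.

Theorem theorem4 (R : realType) (S : metricType R) (sys : system S)
    (P : nat -> metricType R) (sigma : forall t, memory sys t -> P t)
    (psi : selections sigma) (eps : nat -> R)
    (ghat : forall t, P t -> actions sys) :
  approx_info_states psi eps ->
  (forall t (p : P t), (t <= horizon sys)%N -> p \in infos sigma t ->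
     forall u, Qhat sigma p (ghat t p) <= Qhat sigma p u) ->
  let g := fun t (m : memory sys t) => ghat t (sigma t m) in
  forall t (m : memory sys t), (t <= horizon sys)%N -> m \in memories sys t ->
    (forall u, `|Q m u - Theta g m u| <= (2 * alpha sigma eps t)%:E) /\
    `|V m - Lambda g m| <= (2 * alpha sigma eps t)%:E.
Proof.
move=> ais ghat_min g t m tT mM.
have QTh u := Q_Theta_Qhat_close ais ghat_min u (subnKC tT) mM.
rewrite mulr_natl mulr2n; split=> [u|].
  by have [Qu Thu] := QTh u; exact: close_trans Qu (close_sym Thu).
apply: close_trans (close_sym (Lambda_Vhat_close ghat_min tT mM _)).
  by apply: V_Vhat_close => u; case: (QTh u).
by move=> u; case: (QTh u).
Qed.
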